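(* Let $G$ be a connected graph with maximum degree $\Delta$ and minimum degree $\delta$. Then $$\frac{2\sqrt{2}}{3\Delta}SDD(G)+\frac{\sqrt{2}}{3}H(G)\leq BSO(G)\leq \frac{\sqrt{2}}{\delta}SDD(G),$$ with equality (in either inequality) if and only if $G$ is a regular graph.
   Context: Graphs are finite, simple and undirected. For a connected graph $G$ with edge set $E(G)$, $d_v$ denotes the degree of the vertex $v$ in $G$. The first Banhatti-Sombor index is $BSO(G)=\sum_{uv\in E(G)}\sqrt{\frac{1}{d_u^2}+\frac{1}{d_v^2}}$, the symmetric division deg index is $SDD(G)=\sum_{uv\in E(G)}\frac{d_u^2+d_v^2}{2d_ud_v}$, and the harmonic index is $H(G)=\sum_{uv\in E(G)}\frac{2}{d_u+d_v}$. *)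

(* Defs.v *)
From mathcomp Require Import all_boot all_order all_algebra.

Set Implicit Arguments.
Unset Strict Implicit.
Unset Printing Implicit Defensive.

Import Order.TTheory GRing.Theory Num.Theory.

Local Open Scope ring_scope.

Record sgraph := SGraph {
  vertex :> finType;
  adj : rel vertex;
  adj_sym : symmetric adj;
  adj_irr : irreflexive adj
}.

(* An edge is the two-element set of its endpoints, so each is counted once. *)
Definition edges (G : sgraph) : {set {set G}} :=
  [set e | [exists u : G, exists v : G, adj u v && (e == [set u; v])]].

Definition degree (G : sgraph) (u : G) : nat := #|[set v : G | adj u v]|.

Definition max_degree (G : sgraph) : nat := (\max_(v : G) degree v)%N.

(* Degrees are less than #|G|, so as soon as G has a vertex the default value
   #|G| plays no role and this is the least degree. *)
Definition min_degree (G : sgraph) : nat :=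
  \big[minn/#|G|]_(v : G) degree v.

Definition connected (G : sgraph) : Prop :=
  (0 < #|G|)%N /\ forall u v : G, connect (@adj G) u v.

Definition regular (G : sgraph) : Prop :=
  exists k : nat, forall v : G, degree v = k.

Section Indices.

Variables (R : rcfType) (G : sgraph).

(* In these summands w ranges over the two endpoints of the edge e; lemmas
   BSO_termE, SDD_termE and harmonic_termE give the form with named
   endpoints. *)
Definition BSO_term (e : {set G}) : R :=
  Num.sqrt (\sum_(w in e) 1 / (degree w)%:R ^+ 2).

Definition SDD_term (e : {set G}) : R :=
  (\sum_(w in e) (degree w)%:R ^+ 2) / (2 * \prod_(w in e) (degree w)%:R).

Definition harmonic_term (e : {set G}) : R :=
  2 / \sum_(w in e) (degree w)%:R.

Definition BSO : R := \sum_(e in edges G) BSO_term e.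

Definition SDD : R := \sum_(e in edges G) SDD_term e.

Definition harmonic : R := \sum_(e in edges G) harmonic_term e.

Lemma adj_neq (u v : G) : adj u v -> u != v.
Proof. by apply: contraTneq => ->; rewrite adj_irr. Qed.

Lemma BSO_termE (u v : G) : adj u v ->
  BSO_term [set u; v] =
  Num.sqrt (1 / (degree u)%:R ^+ 2 + 1 / (degree v)%:R ^+ 2).
Proof.
by move=> uv; rewrite /BSO_term big_setU1 ?inE ?adj_neq //= big_set1.
Qed.

Lemma SDD_termE (u v : G) : adj u v ->
  SDD_term [set u; v] =
  ((degree u)%:R ^+ 2 + (degree v)%:R ^+ 2) /
  (2 * (degree u)%:R * (degree v)%:R).
Proof.
move=> uv; rewrite /SDD_term !big_setU1 ?inE ?adj_neq //=.
by rewrite !big_set1 mulrA.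
Qed.

Lemma harmonic_termE (u v : G) : adj u v ->
  harmonic_term [set u; v] = 2 / ((degree u)%:R + (degree v)%:R).
Proof.
by move=> uv; rewrite /harmonic_term big_setU1 ?inE ?adj_neq //= big_set1.
Qed.

End Indices.

(* Main.v *)
Require Import Defs.
From mathcomp Require Import all_boot all_order all_algebra.
From mathcomp Require Import ring.
Import Order.TTheory GRing.Theory Num.Theory.
Local Open Scope ring_scope.

(** Let an edge have endpoint degrees [a], [b], and put [q = sqrt (a^2 + b^2)].
    Its contribution to the Banhatti-Sombor index is [q / (a b)], and its
    contribution to SDD is [q^2 / (2 a b)], which is [q / 2] times the former.
    If [delta <= a, b <= Delta], then
    [sqrt 2 * delta <= q <= sqrt 2 * Delta], so edge by edge
      [sqrt 2 / Delta * SDD_e <= BSO_e <= sqrt 2 / delta * SDD_e],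
    with equality exactly when both degrees are the extreme one
    ([leif_SDD_BSO], [leif_BSO_SDD]).  Moreover
    [sqrt 2 * H_e <= BSO_e], with equality exactly when [a = b]: this is the
    inequality between the harmonic and the quadratic mean of [a] and [b]
    ([leif_harmonic_BSO]).  The lower bound of the theorem is the convex
    combination of the two lower estimates with weights 2/3 and 1/3
    ([leif_SDD_harmonic_BSO]).

    Summing over the edges, equality in either bound means that all edges have
    both endpoint degrees equal to [d], the maximal or minimal degree.  As
    degrees then agree along every edge, connectedness makes the graph regular
    ([regularP]).  Connectedness also makes all degrees positive as soon as
    there is an edge, so that the division by [delta] is meaningful. *)

(** * Means of two positive numbers, with their equality cases *)

Section Means.

Variable R : rcfType.
Implicit Types a b c d x y : R.

Lemma leif_pM2l c x y C : 0 < c ->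
  x <= y ?= iff C -> c * x <= c * y ?= iff C.
Proof.
move=> c0 [le_xy <-]; split; first by rewrite ler_pM2l.
by apply/inj_eq/mulfI; rewrite gt_eqF.
Qed.

Lemma leif_sqrt x y C : 0 <= x ->
  x <= y ?= iff C -> Num.sqrt x <= Num.sqrt y ?= iff C.
Proof.
move=> x0 [le_xy <-]; have y0 := le_trans x0 le_xy.
by split; rewrite ?ler_sqrt ?eqr_sqrt.
Qed.

Lemma leif_sqr x y : 0 <= x -> x <= y -> x ^+ 2 <= y ^+ 2 ?= iff (x == y).
Proof.
by move=> x0 xy; have y0 := le_trans x0 xy; split; rewrite ?ler_sqr ?eqrXn2.
Qed.

Lemma sqrt2M d : 0 <= d -> Num.sqrt 2 * d = Num.sqrt (d ^+ 2 + d ^+ 2).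
Proof.
by move=> d0; rewrite -mulr2n -(mulr_natl (d ^+ 2)) sqrtrM ?ler0n // sqrtr_sqr ger0_norm.
Qed.

Lemma leif_min_norm a b d : 0 <= d -> d <= a -> d <= b ->
  Num.sqrt 2 * d <= Num.sqrt (a ^+ 2 + b ^+ 2) ?= iff (a == d) && (b == d).
Proof.
move=> d0 da db; rewrite sqrt2M // ![_ == d]eq_sym.
apply: leif_sqrt; first by rewrite addr_ge0 ?sqr_ge0.
by apply: leifD; apply: leif_sqr.
Qed.

Lemma leif_norm_max a b d : 0 <= a -> 0 <= b -> a <= d -> b <= d ->
  Num.sqrt (a ^+ 2 + b ^+ 2) <= Num.sqrt 2 * d ?= iff (a == d) && (b == d).
Proof.
move=> a0 b0 ad bd; rewrite sqrt2M ?(le_trans a0) //.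
apply: leif_sqrt; first by rewrite addr_ge0 ?sqr_ge0.
by apply: leifD; apply: leif_sqr.
Qed.

(** The harmonic mean is at most the quadratic mean: after squaring, the
    difference of the two sides is [(a - b)^2] times a positive factor. *)
Lemma leif_harmonic_quadratic a b : 0 < a -> 0 < b ->
  Num.sqrt 2 * (2 * (a * b) / (a + b)) <= Num.sqrt (a ^+ 2 + b ^+ 2)
    ?= iff (a == b).
Proof.
move=> a0 b0; have s0 : 0 < a + b by rewrite addr_gt0.
have ab0 : 0 < a * b by rewrite mulr_gt0.
rewrite sqrt2M; last by rewrite divr_ge0 ?mulr_ge0 ?ler0n // ltW.
apply: leif_sqrt; first by rewrite addr_ge0 ?sqr_ge0.
set m := _ + _; set n := _ + _.
pose K := (a ^+ 2 + b ^+ 2 + 4 * (a * b)) / (a + b) ^+ 2.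
have K0 : 0 < K.
  by rewrite divr_gt0 ?addr_gt0 ?exprn_gt0 ?(mulr_gt0 (ltr0n _ 4)).
have dE : n - m = K * (a - b) ^+ 2 by rewrite /n /m /K; field; apply: lt0r_neq0.
split; first by rewrite -subr_ge0 dE mulr_ge0 ?sqr_ge0 // ltW.
by rewrite eq_sym -subr_eq0 dE mulf_eq0 gt_eqF //= sqrf_eq0 subr_eq0.
Qed.

End Means.

(** * The three indices on one edge *)

Section EdgeBounds.

Variables (R : rcfType) (a b : R).
Hypotheses (a0 : 0 < a) (b0 : 0 < b).

Let q := Num.sqrt (a ^+ 2 + b ^+ 2).
Let bso := Num.sqrt (1 / a ^+ 2 + 1 / b ^+ 2).
Let sdd := (a ^+ 2 + b ^+ 2) / (2 * a * b).

Let an0 : a != 0. Proof. exact: lt0r_neq0. Qed.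
Let bn0 : b != 0. Proof. exact: lt0r_neq0. Qed.
Let ab0 : 0 < a * b. Proof. exact: mulr_gt0. Qed.

Let q0 : 0 < q.
Proof. by rewrite sqrtr_gt0 addr_gt0 ?exprn_gt0. Qed.

Let sqrt2_gt0 : 0 < Num.sqrt 2 :> R.
Proof. by rewrite sqrtr_gt0 ltr0n. Qed.

Let bsoE : bso = (a * b)^-1 * q.
Proof.
have -> : (a * b)^-1 = Num.sqrt ((a * b)^-1 ^+ 2).
  by rewrite sqrtr_sqr ger0_norm // invr_ge0 ltW.
rewrite /q -sqrtrM ?sqr_ge0 //; congr Num.sqrt.
by field; rewrite an0 bn0.
Qed.

(** [sqrt 2 / d * sdd] is [bso] with one factor [q] replaced by
    [q^2 / (sqrt 2 * d)], so it compares with [bso] as [q] with [sqrt 2 * d]. *)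
Let sdd_factor d : 0 < d ->
  Num.sqrt 2 / d * sdd = q / (a * b * (Num.sqrt 2 * d)) * q.
Proof.
move=> d0; have qq : q * q = a ^+ 2 + b ^+ 2.
  by rewrite -expr2 sqr_sqrtr // addr_ge0 ?sqr_ge0.
have ss : Num.sqrt 2 * Num.sqrt 2 = 2 :> R by rewrite -expr2 sqr_sqrtr ?ler0n.
rewrite /sdd -qq -{2}ss; field.
by rewrite an0 bn0 !lt0r_neq0.
Qed.

Let bso_factor d : 0 < d ->
  bso = q / (a * b * (Num.sqrt 2 * d)) * (Num.sqrt 2 * d).
Proof. by move=> d0; rewrite bsoE; field; rewrite an0 bn0 !lt0r_neq0. Qed.

Let coef_gt0 d : 0 < d -> 0 < q / (a * b * (Num.sqrt 2 * d)).
Proof. by move=> d0; rewrite divr_gt0 // !mulr_gt0. Qed.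

Lemma leif_BSO_SDD d : 0 < d -> d <= a -> d <= b ->
  bso <= Num.sqrt 2 / d * sdd ?= iff (a == d) && (b == d).
Proof.
move=> d0 da db; rewrite sdd_factor // (bso_factor _ d0).
by apply: leif_pM2l; [exact: coef_gt0 | apply: leif_min_norm => //; apply: ltW].
Qed.

Lemma leif_SDD_BSO d : a <= d -> b <= d ->
  Num.sqrt 2 / d * sdd <= bso ?= iff (a == d) && (b == d).
Proof.
move=> ad bd; have d0 := lt_le_trans a0 ad; rewrite sdd_factor // (bso_factor _ d0).
by apply: leif_pM2l; [exact: coef_gt0 | apply: leif_norm_max => //; apply: ltW].
Qed.

Lemma leif_harmonic_BSO :
  Num.sqrt 2 * (2 / (a + b)) <= bso ?= iff (a == b).
Proof.
have -> : Num.sqrt 2 * (2 / (a + b)) =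
    (a * b)^-1 * (Num.sqrt 2 * (2 * (a * b) / (a + b))).
  by field; rewrite an0 bn0 lt0r_neq0 ?addr_gt0.
rewrite bsoE; apply: leif_pM2l; first by rewrite invr_gt0.
exact: leif_harmonic_quadratic.
Qed.

Lemma leif_SDD_harmonic_BSO d : a <= d -> b <= d ->
  2 * Num.sqrt 2 / (3 * d) * sdd + Num.sqrt 2 / 3 * (2 / (a + b)) <= bso
    ?= iff (a == d) && (b == d).
Proof.
move=> ad bd; have d0 := lt_le_trans a0 ad.
have -> : 2 * Num.sqrt 2 / (3 * d) * sdd + Num.sqrt 2 / 3 * (2 / (a + b)) =
    2 / 3 * (Num.sqrt 2 / d * sdd) + 1 / 3 * (Num.sqrt 2 * (2 / (a + b))).
  by rewrite /sdd; field; rewrite an0 bn0 !lt0r_neq0 ?addr_gt0.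
have -> : bso = 2 / 3 * bso + 1 / 3 * bso by field.
have -> : (a == d) && (b == d) = ((a == d) && (b == d)) && (a == b).
  by case: eqP => [->|] //=; rewrite [d == b]eq_sym andbb.
apply: leifD; apply: leif_pM2l; rewrite ?divr_gt0 ?ltr0n //.
  exact: leif_SDD_BSO.
exact: leif_harmonic_BSO.
Qed.

End EdgeBounds.

(** * Degrees in a connected graph *)

Section Degrees.

Variable G : sgraph.

Lemma edgesP (e : {set G}) :
  reflect (exists u v : G, adj u v /\ e = [set u; v]) (e \in edges G).
Proof.
rewrite inE; apply: (iffP existsP) => [[u /existsP[v /andP[uv /eqP->]]]|].
  by exists u, v.
by case=> u [v [uv ->]]; exists u; apply/existsP; exists v; rewrite uv eqxx.
Qed.

Lemma degree_le_max (u : G) : (degree u <= max_degree G)%N.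
Proof. exact: leq_bigmax. Qed.

Lemma min_le_degree (u : G) : (min_degree G <= degree u)%N.
Proof. by rewrite /min_degree -minEnat -leEnat; apply: bigmin_le. Qed.

Lemma max_degree_const k : (0 < #|G|)%N -> (forall v : G, degree v = k) ->
  max_degree G = k.
Proof.
case/card_gt0P=> u _ degk; apply/eqP; rewrite eqn_leq -{2}(degk u).
rewrite degree_le_max andbT; apply/bigmax_leqP => v _.
by rewrite degk.
Qed.

Lemma min_degree_const k : (0 < #|G|)%N -> (forall v : G, degree v = k) ->
  min_degree G = k.
Proof.
case/card_gt0P=> u _ degk; apply/eqP; rewrite eqn_leq -{1}(degk u).
rewrite min_le_degree /=; rewrite /min_degree.
elim/big_ind: _ => [|x y kx ky|v _]; last by rewrite degk.
  (* The default value of the minimum is at least every degree. *)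
  by rewrite -(degk u) max_card.
by rewrite leq_min kx.
Qed.

(** Having a neighbour propagates along edges, hence to the whole graph. *)
Lemma min_degree_gt0 (u v : G) : connected G -> adj u v -> (0 < min_degree G)%N.
Proof.
move=> [G0 conG] uv.
have pos (x y : G) : adj x y -> (0 < degree x)%N.
  by move=> xy; apply/card_gt0P; exists y; rewrite inE.
have clos : closed (@adj G) [pred w : G | 0 < degree w]%N.
  by move=> x y xy; rewrite !inE (pos x y) // (pos y x) // adj_sym.
rewrite /min_degree; elim/big_ind: _ => [//|x y x0 y0|w _].
  by rewrite leq_min x0.
by have := closed_connect clos (conG u w); rewrite !inE (pos u v).
Qed.

(** The boolean side is the equality condition obtained by summing the
    edge estimates.  The second hypothesis pins [d] down for a regular graph;
    it holds for the minimal and for the maximal degree.  Recovering regularity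
    needs no isolated-vertex case: the set of vertices sharing the degree of a
    given one is closed under adjacency. *)
Lemma regularP d : connected G ->
  (forall k, (forall v : G, degree v = k) -> d = k) ->
  reflect (regular G)
    [forall (e | e \in edges G), [forall w in e, degree w == d]].
Proof.
move=> [G0 conG] dk; apply: (iffP forall_inP) => [edge_d | [k degk] e _].
  have [u _] := card_gt0P G0; exists (degree u) => v.
  have adj_d (x y : G) : adj x y -> degree x = d.
    move=> xy; have /edge_d/forall_inP dd : [set x; y] \in edges G.
      by apply/edgesP; exists x, y.
    by apply/eqP/dd; rewrite !inE eqxx.
  have clos : closed (@adj G) [pred w : G | degree w == degree u].
    by move=> x y xy; rewrite !inE (adj_d x y) // (adj_d y x) // adj_sym.
  by have := closed_connect clos (conG u v); rewrite !inE eqxx => /esym/eqP.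
by apply/forall_inP => w _; rewrite degk (dk k).
Qed.

Lemma edge_degreesE (R : numDomainType) d (u v : G) :
  [forall w in [set u; v], degree w == d] =
  ((degree u)%:R == d%:R :> R) && ((degree v)%:R == d%:R :> R).
Proof.
rewrite !eqr_nat; apply/forall_inP/andP => [dd | [du dv] w].
  by split; apply: dd; rewrite !inE eqxx ?orbT.
by rewrite !inE => /orP[] /eqP->.
Qed.

End Degrees.

Theorem theorem3p11 (R : rcfType) (G : sgraph) (hG : connected G) :
  let Delta : R := (max_degree G)%:R in
  let delta : R := (min_degree G)%:R in
  let lower : R :=
    2 * Num.sqrt 2 / (3 * Delta) * SDD R G + Num.sqrt 2 / 3 * harmonic R G in
  let upper : R := Num.sqrt 2 / delta * SDD R G in
  [/\ lower <= BSO R G,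
      BSO R G <= upper,
      lower = BSO R G <-> regular G
    & BSO R G = upper <-> regular G].
Proof.
move=> Delta delta lower upper.
have G0 : (0 < #|G|)%N by case: hG.
have deg_gt0 (u v w : G) : adj u v -> 0 < (degree w)%:R :> R.
  move=> uv; rewrite ltr0n; apply: leq_trans (min_le_degree G w).
  exact: min_degree_gt0 G u v hG uv.
have leif_lower : lower <= BSO R G ?= iff
    [forall (e | e \in edges G), [forall w in e, degree w == max_degree G]].
  rewrite /lower /SDD /harmonic !mulr_sumr -big_split /=.
  apply: leif_sum => _ /edgesP[u [v [uv ->]]].
  rewrite (edge_degreesE _ R) BSO_termE // SDD_termE // harmonic_termE //.
  by apply: leif_SDD_harmonic_BSO;
    rewrite ?ler_nat ?degree_le_max ?(deg_gt0 u v).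
have leif_upper : BSO R G <= upper ?= iff
    [forall (e | e \in edges G), [forall w in e, degree w == min_degree G]].
  rewrite /upper /SDD mulr_sumr.
  apply: leif_sum => _ /edgesP[u [v [uv ->]]].
  rewrite (edge_degreesE _ R) BSO_termE // SDD_termE //.
  apply: leif_BSO_SDD; rewrite ?ler_nat ?min_le_degree ?(deg_gt0 u v) //.
  by rewrite ltr0n; apply: min_degree_gt0 G u v hG uv.
have regmax := regularP G (max_degree G) hG (fun k => max_degree_const G k G0).
have regmin := regularP G (min_degree G) hG (fun k => min_degree_const G k G0).
split; [exact: leif_lower.1 | exact: leif_upper.1 | |].
  by rewrite (rwP eqP) leif_lower.2; split=> /regmax.
by rewrite (rwP eqP) leif_upper.2; split=> /regmin.
Qed.
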